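(* Let $r$ be a positive integer and let $\Gamma$ be a finite connected graph of genus $g$ with vertex set $V$, regarded as a metric graph in which each edge has length one. On each edge introduce $r-1$ vertices placed equidistantly, so that the edge is divided into $r$ equal parts, and let $V^{reg}$ be the union of $V$ with all these new vertices. Then there are $r^{g}$ pairwise linearly inequivalent divisors supported on $V^{reg}$ whose classes form the subgroup $\mathrm{Pic}^0(\Gamma)[r]$ of $r$-torsion elements of $\mathrm{Pic}^0(\Gamma)$.
   Context: Graphs are finite and undirected; multiple edges and loops are allowed. The genus of a connected graph is its first Betti number $|E|-|V|+1$. The metric graph is the metric space obtained by viewing each edge as a line segment of length one. A divisor on $\Gamma$ is a finite formal $\mathbb{Z}$-linear combination of points of the metric space; its degree is the sum of its coefficients. A principal divisor is the divisor of a continuous piecewise linear function with integer slopes (coefficient at a point = sum of outgoing slopes, up to a global sign convention). Two divisors are linearly equivalent if their difference is principal; $\mathrm{Pic}(\Gamma)$ is the group of divisors modulo principal divisors, and $\mathrm{Pic}^0(\Gamma)$ is the subgroup of degree-zero classes, which is isomorphic to $\mathbb{R}^g/\mathbb{Z}^g$. *)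

(* Defs.v *)
From HB Require Import structures.
From mathcomp Require Import all_boot all_order all_algebra ring lra.
From mathcomp Require Import all_classical reals.
From mathcomp.multinomials Require Import freeg.

Set Implicit Arguments.
Unset Strict Implicit.
Unset Printing Implicit Defensive.

Import Order.TTheory GRing.Theory Num.Theory.
Local Open Scope ring_scope.

(* Multiple edges and loops are allowed. The orientation src -> tgt of an     *)
(* edge only serves to parametrize it by [0, 1].                              *)
Record multigraph := Multigraph {
  vertex : finType;
  edge : finType;
  src : edge -> vertex;
  tgt : edge -> vertex }.

Definition adjacent (G : multigraph) : rel (vertex G) :=
  fun u v => [exists e : edge G, ((src e == u) && (tgt e == v))
                              || ((src e == v) && (tgt e == u))].

Definition connected_graph (G : multigraph) : Prop :=
  (0 < #|vertex G|)%N /\ forall u v : vertex G, connect (@adjacent G) u v.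

(* |E| - |V| + 1; the subtraction does not truncate when G is connected.      *)
Definition genus (G : multigraph) : nat := (#|edge G| + 1 - #|vertex G|)%N.

Local Open Scope classical_set_scope.

Section MetricGraph.
Variables (R : realType) (G : multigraph).

(* The metric graph, with unit edge lengths: a point is either a vertex or a  *)
(* pair (e, t) with 0 < t < 1, interior to the edge e at distance t from      *)
(* src e.                                                                     *)
Definition edge_interior : Type := {x : edge G * R | 0 < x.2 < 1}.
Definition point : choiceType := (vertex G + edge_interior)%type.

(* The unit-speed parametrization of the closed edge e by t \in [0, 1].       *)
Definition edge_point (e : edge G) (t : R) : point :=
  if insub (e, t) is Some x then inr x
  else inl (if t <= 0 then src e else tgt e).

(* Continuous piecewise linear functions with integer slopes: on each edge, s *)
(* lists the breakpoints. The pieces [a, b] are closed, so that f is          *)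
(* continuous at the breakpoints and at the vertices.                         *)
Definition pl_function (f : point -> R) : Prop :=
  forall e : edge G, exists s : seq R, forall a b : R,
    0 <= a -> a <= b -> b <= 1 -> (forall c, c \in s -> ~~ (a < c < b)) ->
    exists m : int, forall t, a <= t <= b ->
      f (edge_point e t) = f (edge_point e a) + m%:~R * (t - a).

(* At the point t of e, f has slope m in the direction of tgt e if            *)
(* back = false, of src e if back = true.                                     *)
Definition has_slope (f : point -> R) (e : edge G) (t : R) (back : bool)
    (m : int) : Prop :=
  exists2 eps : R, 0 < eps & forall h, 0 <= h <= eps ->
    f (edge_point e (t + (-1) ^+ back * h)) = f (edge_point e t) + m%:~R * h.

(* For a piecewise linear f, such an m exists and is unique, provided that    *)
(* the direction does not leave e (pl_fwd, pl_bwd, has_slopeP below).         *)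
Definition outgoing_slope (f : point -> R) (e : edge G) (t : R) (back : bool)
    : int :=
  xget 0 [set m | has_slope f e t back m].

(* A loop at v contributes two tangent directions at v.                       *)
Definition slope_sum (f : point -> R) (p : point) : int :=
  match p with
  | inl v => \sum_(e | src e == v) outgoing_slope f e 0 false
             + \sum_(e | tgt e == v) outgoing_slope f e 1 true
  | inr x => let: (e, t) := val x in
             outgoing_slope f e t false + outgoing_slope f e t true
  end.

Definition divisor : zmodType := {freeg point}.

Definition principal : {pred divisor} := [pred D : divisor |
  `[< exists2 f, pl_function f & forall p, coeff p D = slope_sum f p >]].

Definition lin_equiv (D D' : divisor) : Prop := D - D' \in principal.

Lemma has_slopeP f e t back m :
  has_slope f e t back m -> outgoing_slope f e t back = m.
Proof.
move=> fm; rewrite /outgoing_slope; case: xgetP => [k _ fk|/(_ m)//].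
case: fm fk => eps eps0 fm [del del0 fk].
have h0 : 0 < Num.min eps del by rewrite lt_min eps0.
have h1 : 0 <= Num.min eps del <= eps by rewrite ltW //= ge_min lexx.
have h2 : 0 <= Num.min eps del <= del by rewrite ltW //= ge_min lexx orbT.
have := fm _ h1; rewrite (fk _ h2) => /addrI /(mulIf (lt0r_neq0 h0)).
by move/eqP; rewrite eqr_int => /eqP.
Qed.

Lemma gap (s : seq R) (t u : R) : t < u ->
  exists2 w, t < w <= u & forall c, c \in s -> ~~ (t < c < w).
Proof.
move=> tu; elim: s => [|c s [w /andP[tw wu] sP]].
  by exists u => //; rewrite tu lexx.
case: (boolP (t < c < w)) => [/andP[tc cw]|ncw].
  exists c => [|d]; first by rewrite tc (ltW (lt_le_trans cw wu)).
  rewrite inE => /orP[/eqP->|/sP]; first by rewrite ltxx andbF.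
  by apply: contra => /andP[-> /lt_trans->].
exists w => [|d]; first by rewrite tw.
by rewrite inE => /orP[/eqP->|/sP].
Qed.

Lemma pl_fwd f e t : pl_function f -> 0 <= t < 1 ->
  exists m, has_slope f e t false m.
Proof.
move=> /(_ e)[s fP] /andP[t0 t1].
have [w /andP[tw w1] sP] := gap s t1.
have [m mP] := fP t w t0 (ltW tw) w1 sP.
exists m, (w - t); first by lra.
move=> h hh; rewrite expr0 mul1r mP; last by lra.
by congr (_ + _ * _); lra.
Qed.

Lemma pl_bwd f e t : pl_function f -> 0 < t <= 1 ->
  exists m, has_slope f e t true m.
Proof.
move=> /(_ e)[s fP] /andP[t0 t1].
have t0' : - t < 0 by lra.
have [w /andP[tw w1] sP] := gap [seq - c | c <- s] t0'.
have sP' c : c \in s -> ~~ (- w < c < t).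
  move=> cs; have := sP (- c) (map_f _ cs); apply: contra; lra.
have w0 : 0 <= - w by lra.
have wt : - w <= t by lra.
have [m mP] := fP (- w) t w0 wt t1 sP'.
exists (- m), (t + w); first by lra.
move=> h hh; rewrite expr1 mulN1r mP; last by lra.
rewrite (mP t); last by lra.
by rewrite rmorphN /=; lra.
Qed.

Lemma pl_cst0 : pl_function (fun=> 0).
Proof.
move=> e; exists [::] => a b _ _ _ _; exists 0 => t _.
by rewrite mul0r addr0.
Qed.

Lemma pl_sub f g : pl_function f -> pl_function g ->
  pl_function (fun p => f p - g p).
Proof.
move=> fP gP e; have [s fs] := fP e; have [s' gs] := gP e.
exists (s ++ s') => a b a0 ab b1 cP.
have [m mP] := fs a b a0 ab b1 (fun c cs => cP c ltac:(by rewrite mem_cat cs)).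
have [k kP] := gs a b a0 ab b1
  (fun c cs => cP c ltac:(by rewrite mem_cat cs orbT)).
by exists (m - k) => t tab; rewrite mP // kP // rmorphB /=; ring.
Qed.

Lemma has_slope_cst0 e t back : has_slope (fun=> 0) e t back 0.
Proof. by exists 1 => // h _; rewrite mul0r addr0. Qed.

Lemma has_slope_sub f g e t back m k :
  has_slope f e t back m -> has_slope g e t back k ->
  has_slope (fun p => f p - g p) e t back (m - k).
Proof.
move=> [eps eps0 fm] [del del0 gk]; exists (Num.min eps del).
  by rewrite lt_min eps0.
move=> h; rewrite le_min => /and3P[h0 h1 h2].
by rewrite fm ?h0 // gk ?h0 // rmorphB /=; ring.
Qed.

Lemma slope_sum0 p : slope_sum (fun=> 0) p = 0.
Proof.
have os0 e t back : outgoing_slope (fun=> 0) e t back = 0.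
  exact/has_slopeP/has_slope_cst0.
case: p => [v|x] /=; first by rewrite !big1.
by case: (val x) => e t; rewrite !os0.
Qed.

Lemma slope_sumB f g p : pl_function f -> pl_function g ->
  slope_sum (fun q => f q - g q) p = slope_sum f p - slope_sum g p.
Proof.
move=> fP gP.
have fwd e t : 0 <= t < 1 -> outgoing_slope (fun q => f q - g q) e t false
    = outgoing_slope f e t false - outgoing_slope g e t false.
  move=> t01; have [m mP] := pl_fwd e fP t01; have [k kP] := pl_fwd e gP t01.
  by rewrite (has_slopeP mP) (has_slopeP kP) (has_slopeP (has_slope_sub mP kP)).
have bwd e t : 0 < t <= 1 -> outgoing_slope (fun q => f q - g q) e t true
    = outgoing_slope f e t true - outgoing_slope g e t true.
  move=> t01; have [m mP] := pl_bwd e fP t01; have [k kP] := pl_bwd e gP t01.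
  by rewrite (has_slopeP mP) (has_slopeP kP) (has_slopeP (has_slope_sub mP kP)).
case: p => [v|x] /=.
  under eq_bigr do rewrite fwd ?lexx ?ltr01 //.
  under [X in _ + X = _]eq_bigr do rewrite bwd ?lexx ?ltr01 //.
  by rewrite !sumrB; ring.
case: x => -[e t] /= /andP[t0 t1].
by rewrite fwd ?bwd ?t0 ?t1 ?ltW //; ring.
Qed.

Lemma principal_zmod_closed : zmod_closed principal.
Proof.
split=> [|D D' /asboolP[f fP Df] /asboolP[g gP Dg]]; apply/asboolP.
  by exists (fun=> 0); [exact: pl_cst0|move=> p; rewrite slope_sum0 coeff0].
exists (fun p => f p - g p); first exact: pl_sub.
by move=> p; rewrite slope_sumB // coeffB Df Dg.
Qed.

HB.instance Definition _ :=
  GRing.isZmodClosed.Build divisor principal principal_zmod_closed.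

Definition Pic : zmodType := Quotient.quot principal.

Definition divisor_class (D : divisor) : Pic :=
  (\pi_(Quotient.quot principal) D)%qT.

Definition Pic0 : set Pic := [set divisor_class D | D in [set D | deg D = 0]].

Definition Pic0_torsion (r : nat) : set Pic :=
  [set c | Pic0 c /\ c *+ r = 0].

(* V^reg: the vertices of G and the points dividing each edge into r equal    *)
(* parts.                                                                     *)
Definition Vreg (r : nat) : {pred point} := fun p =>
  match p with
  | inl _ => true
  | inr x => [exists k : 'I_r, (val x).2 == k%:R / r%:R]
  end.

End MetricGraph.

(* Main.v *)
(* If r D = div f, then on each edge the slopes of f are congruent modulo r   *)
(* to a constant, because f bends by multiples of r inside the edge; these    *)
(* constants form a cycle c with coefficients in Z/r, since the outgoing      *)
(* slopes at a vertex also add up to a multiple of r. The cycle determines    *)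
(* the class of D: if c = 0, then f / r has integer slopes. Conversely, a     *)
(* cycle c comes from the function that vanishes on the vertices and has      *)
(* slopes c(e) and c(e) - r on the edge e; it bends at distance (r - c(e)) /  *)
(* r from the source of e, hence in V^reg. Finally, a connected graph has r^g *)
(* cycles.                                                                    *)

Require Import Defs.
From HB Require Import structures.
From mathcomp Require Import all_boot all_order all_algebra ring lra zify.
From mathcomp Require Import all_classical reals.
From mathcomp.multinomials Require Import freeg.

Set Implicit Arguments.
Unset Strict Implicit.
Unset Printing Implicit Defensive.

Import Order.TTheory GRing.Theory Num.Theory.
Local Open Scope ring_scope.

(** The [r]-torsion classes of degree zero correspond to the cycles of the graph with coefficients
    in Z/r. For a cycle [c], the divisor of [tent c] is divisible by [r], and the quotient
    [torsion_divisor c] is an explicit representative on [Vreg r] whose class is killed by [r].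
    Every torsion class arises so ([torsion_divisor_surj]): if r D = div f, let [c] be the initial
    slopes of [f] modulo [r]. All slopes of [tent c - f] are then multiples of [r] by
    [slope_constant_mod], so dividing by [r] gives the required equivalence. Different cycles give
    inequivalent divisors ([torsion_divisor_inj]): an equivalence through [h] makes
    [tent c - tent c' - r h] harmonic, hence of slope zero by [harmonic_flat], so [c] and [c'] agree
    modulo [r]. There are r^g cycles ([card_cycles]): they form the kernel of [boundary], whose
    image, by connectedness, is the kernel of [total]. *)

HB.instance Definition _ (E : finType) (M : finZmodType) :=
  Finite.on {ffun E -> M}.

(** Each nonempty fibre is a translate of the kernel. *)
Lemma card_additive (A B : finZmodType) (f : {additive A -> B}) :
  #|A| = (#|f @: [set: A]| * #|[set a | f a == 0%R]|)%N.
Proof.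
rewrite -cardsT -sum1_card (partition_big_imset f) /=.
rewrite -sum_nat_const; apply: eq_bigr => _ /imsetP[a _ ->].
rewrite sum1_card -[RHS](card_imset _ (addrI a)).
apply: eq_card => b; rewrite [LHS]inE.
apply/idP/imsetP => [/andP[_ /eqP fb]|[k]].
  by exists (b - a); rewrite ?inE ?raddfB /= ?fb ?subrr // addrC subrK.
by rewrite inE => /eqP fk ->; rewrite raddfD /= fk addr0 eqxx inE.
Qed.

Lemma sum_fibers (I J : finType) (M : nmodType) (h : I -> J) (F : J -> I -> M) :
  \sum_j \sum_(i | h i == j) F j i = \sum_i F (h i) i.
Proof.
rewrite (exchange_big_dep xpredT) //=; apply: eq_bigr => i _.
by rewrite (big_pred1 (h i)) // => j; rewrite eq_sym.
Qed.

(** * Boundary map of a graph and the number of its cycles *)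

Section Boundary.
Variables (G : multigraph) (M : zmodType).
Implicit Types c : {ffun edge G -> M}.

Definition boundary c : {ffun vertex G -> M} :=
  [ffun v => \sum_(e | src e == v) c e - \sum_(e | tgt e == v) c e].

Lemma boundary_is_additive : zmod_morphism boundary.
Proof.
move=> c c'; apply/ffunP => v; rewrite !ffunE.
under eq_bigr do rewrite !ffunE.
under [X in _ - X]eq_bigr do rewrite !ffunE.
by rewrite !sumrB !opprD !opprK addrACA.
Qed.

HB.instance Definition _ :=
  GRing.isZmodMorphism.Build _ _ boundary boundary_is_additive.

Definition total (f : {ffun vertex G -> M}) : M := \sum_v f v.

Lemma total_is_additive : zmod_morphism total.
Proof.
by move=> f f'; rewrite -sumrB; apply: eq_bigr => v _; rewrite !ffunE.
Qed.

HB.instance Definition _ :=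
  GRing.isZmodMorphism.Build _ _ total total_is_additive.

Definition point_mass (v : vertex G) (m : M) : {ffun vertex G -> M} :=
  [ffun w => m *+ (w == v)].

Lemma total_point_mass v m : total (point_mass v m) = m.
Proof.
rewrite /total (bigD1 v) //= ffunE eqxx big1 ?addr0 // => w /negPf wv.
by rewrite ffunE wv.
Qed.

Lemma sum_pred1_mass (I : finType) (P : pred I) (i : I) (m : M) :
  \sum_(j | P j) m *+ (j == i) = m *+ P i.
Proof.
rewrite big_mkcond (bigD1 i) //= eqxx big1 ?addr0 => [|j /negPf ->].
  by case: (P i).
by case: (P j).
Qed.

Lemma boundary_edge e m :
  boundary [ffun e' => m *+ (e' == e)]
  = point_mass (src e) m - point_mass (tgt e) m.
Proof.
apply/ffunP => v; rewrite !ffunE.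
under eq_bigr do rewrite !ffunE.
under [X in _ - X]eq_bigr do rewrite !ffunE.
by rewrite !sum_pred1_mass ![v == _]eq_sym.
Qed.

Lemma total_boundary c : total (boundary c) = 0.
Proof.
rewrite /total; under eq_bigr do rewrite ffunE.
by rewrite sumrB (sum_fibers _ (fun _ e => c e))
  (sum_fibers _ (fun _ e => c e)) subrr.
Qed.

(** The mass is carried along a path one edge at a time, with a sign when an edge is traversed
    against its orientation. *)
Lemma boundary_connect u v m : connect (@adjacent G) u v ->
  exists c, boundary c = point_mass v m - point_mass u m.
Proof.
move=> /connectP[p]; elim: p u => [|w p IHp] u /=.
  by move=> _ ->; exists 0; rewrite raddf0 subrr.
move=> /andP[/existsP[e uw] /IHp {}IHp /IHp[c cP]].
suff [c' c'P] : exists c', boundary c' = point_mass w m - point_mass u m.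
  by exists (c + c'); rewrite raddfD /= cP c'P addrA subrK.
case/orP: uw => /andP[/eqP <- /eqP <-].
  by exists [ffun e' => - m *+ (e' == e)]; rewrite boundary_edge;
    apply/ffunP => x; rewrite !ffunE !mulNrn opprK addrC.
by exists [ffun e' => m *+ (e' == e)]; rewrite boundary_edge.
Qed.

(** All masses [f v] are transported from one base vertex [u]; what is taken away at [u] is the
    total, which is zero. *)
Lemma boundary_surj f : connected_graph G -> total f = 0 ->
  exists c, boundary c = f.
Proof.
move=> [/card_gt0P[u _] Gconn] f0.
have /choice[c cP] : forall v, exists c,
    boundary c = point_mass v (f v) - point_mass u (f v).
  by move=> v; exact: boundary_connect (Gconn u v).
exists (\sum_v c v); rewrite raddf_sum /=.
under eq_bigr do rewrite cP.
rewrite sumrB; apply/ffunP => w; rewrite !ffunE !sum_ffunE.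
under eq_bigr do rewrite ffunE.
under [X in _ - X]eq_bigr do rewrite ffunE.
rewrite sumrMnl -[X in _ - X *+ _]/(total f) f0 mul0rn subr0.
rewrite (bigD1 w) //= eqxx big1 ?addr0 // => v /negPf.
by rewrite eq_sym => ->.
Qed.

End Boundary.

Definition cycles (G : multigraph) (M : finZmodType) :=
  [set c : {ffun edge G -> M} | boundary c == 0].

(* The inequality |V| <= |E| + 1, needed for the truncated subtraction in the *)
(* genus, is read off from the cardinalities instead of a spanning tree.      *)
Lemma card_cycles (G : multigraph) (M : finZmodType) : connected_graph G ->
  #|cycles G M| = (#|M| ^ genus G)%N.
Proof.
move=> Gconn; have [/card_gt0P[u _] _] := Gconn.
have := card_additive (@total G M); rewrite card_ffun.
have -> : @total G M @: [set: {ffun vertex G -> M}] = [set: M].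
  apply/setP => m; rewrite inE; apply/imsetP.
  by exists (point_mass u m); rewrite ?total_point_mass.
have := card_additive (@boundary G M); rewrite card_ffun.
have -> : @boundary G M @: [set: {ffun edge G -> M}] = [set f | total f == 0].
  apply/setP => f; rewrite inE; apply/imsetP/eqP => [[c _ ->]|].
    exact: total_boundary.
  by move=> /(boundary_surj Gconn)[c <-]; exists c.
rewrite cardsT /genus.
have V0 : (0 < #|vertex G|)%N by apply/card_gt0P; exists u.
set k := #|[set _ | _]|; rewrite -/(cycles G M); set z := #|cycles G M|.
have z0 : (0 < z)%N by apply/card_gt0P; exists 0; rewrite inE raddf0.
have M0 : (0 < #|M|)%N by apply/card_gt0P; exists 0.
rewrite -(prednK V0) expnS => ekz /eqP; rewrite eqn_pmul2l // => /eqP Vk.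
rewrite -Vk in ekz.
(* Exponents can be compared only when the base exceeds 1; for a trivial group both sides are 1. *)
have [M1|M1] := leqP #|M| 1.
  have {M0 M1}M1 : #|M| = 1%N by apply/eqP; rewrite eqn_leq M1.
  by move: ekz; rewrite M1 !exp1n mul1n.
have VE : (#|vertex G|.-1 <= #|edge G|)%N.
  by rewrite -(leq_exp2l _ _ M1) ekz leq_pmulr.
have MV0 : (0 < #|M| ^ #|vertex G|.-1)%N by rewrite expn_gt0 M0.
apply/eqP; rewrite -(eqn_pmul2l MV0).
rewrite -ekz -expnD; apply/eqP; congr (_ ^ _)%N.
by rewrite addn1 subSS subnKC.
Qed.

(** * Slopes of piecewise linear functions along an edge *)

Section PiecewiseLinear.
Variables (R : realType) (G : multigraph).
Implicit Types (f g : Defs.point R G -> R) (e : edge G) (t a b : R).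

Local Notation fwd f e t := (outgoing_slope f e t false).
Local Notation bwd f e t := (outgoing_slope f e t true).

Lemma edge_point_interior e (x : edge_interior R G) :
  (val x).1 = e -> edge_point e (val x).2 = inr x.
Proof. by move=> <-; rewrite /edge_point -surjective_pairing valK. Qed.

Lemma edge_point0 e : edge_point e 0 = inl (src e) :> Defs.point R G.
Proof. by rewrite /edge_point insubF /= ?ltxx ?lexx. Qed.

Lemma edge_point1 e : edge_point e 1 = inl (tgt e) :> Defs.point R G.
Proof. by rewrite /edge_point insubF /= ?ltxx ?andbF ?ler10. Qed.

Lemma edge_pointI e t : 0 < t < 1 ->
  exists2 x : edge_interior R G, edge_point e t = inr x & val x = (e, t).
Proof.
move=> t01; exists (Sub (e, t) t01); last exact: SubK.
by rewrite /edge_point insubT.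
Qed.

Lemma slope_sum_interior f e t : 0 < t < 1 ->
  slope_sum f (edge_point e t) = fwd f e t + bwd f e t.
Proof. by move=> /(edge_pointI e)[x -> xE]; rewrite /slope_sum xE. Qed.

Lemma has_slopeZ (k : int) f e t back m : has_slope f e t back m ->
  has_slope (fun p => k%:~R * f p) e t back (k * m).
Proof.
move=> [eps eps0 fm]; exists eps => // h /fm ->.
by rewrite rmorphM mulrDr mulrA.
Qed.

Lemma outgoing_fwdB f g e t : pl_function f -> pl_function g -> 0 <= t < 1 ->
  fwd (fun p => f p - g p) e t = fwd f e t - fwd g e t.
Proof.
move=> fP gP t01.
have [m mP] := pl_fwd e fP t01; have [k kP] := pl_fwd e gP t01.
by rewrite (has_slopeP mP) (has_slopeP kP) (has_slopeP (has_slope_sub mP kP)).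
Qed.

Lemma outgoing_fwdZ (k : int) f e t : pl_function f -> 0 <= t < 1 ->
  fwd (fun p => k%:~R * f p) e t = k * fwd f e t.
Proof.
move=> fP t01; have [m mP] := pl_fwd e fP t01.
by rewrite (has_slopeP mP) (has_slopeP (has_slopeZ k mP)).
Qed.

Lemma outgoing_bwdZ (k : int) f e t : pl_function f -> 0 < t <= 1 ->
  bwd (fun p => k%:~R * f p) e t = k * bwd f e t.
Proof.
move=> fP t01; have [m mP] := pl_bwd e fP t01.
by rewrite (has_slopeP mP) (has_slopeP (has_slopeZ k mP)).
Qed.

Lemma pl_scale (k : int) f : pl_function f ->
  pl_function (fun p => k%:~R * f p).
Proof.
move=> fP e; have [s fs] := fP e; exists s => a b a0 ab b1 sab.
have [m mP] := fs a b a0 ab b1 sab; exists (k * m) => t /mP ->.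
by rewrite rmorphM mulrDr mulrA.
Qed.

Lemma slope_sumZ (k : int) f p : pl_function f ->
  slope_sum (fun q => k%:~R * f q) p = k * slope_sum f p.
Proof.
move=> fP; case: p => [v|x] /=.
  under eq_bigr do rewrite outgoing_fwdZ ?lexx ?ltr01 //.
  under [X in _ + X = _]eq_bigr do rewrite outgoing_bwdZ ?lexx ?ltr01 //.
  by rewrite -!mulr_sumr mulrDr.
case: x => -[e t] /= /andP[t0 t1].
by rewrite outgoing_fwdZ ?outgoing_bwdZ ?t0 ?t1 ?ltW //; ring.
Qed.

Lemma affine_fwd f e a b (m : int) :
  (forall t, a <= t <= b ->
    f (edge_point e t) = f (edge_point e a) + m%:~R * (t - a)) ->
  forall t, a <= t < b -> fwd f e t = m.
Proof.
move=> fab t tab; apply/has_slopeP; exists (b - t); first by lra.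
by move=> h hbt; rewrite expr0 mul1r fab ?(fab t) //; [ring|lra|lra].
Qed.

Lemma affine_bwd f e a b (m : int) :
  (forall t, a <= t <= b ->
    f (edge_point e t) = f (edge_point e a) + m%:~R * (t - a)) ->
  forall t, a < t <= b -> bwd f e t = - m.
Proof.
move=> fab t tab; apply/has_slopeP; exists (t - a); first by lra.
move=> h hbt; rewrite expr1 mulN1r fab ?(fab t) //; [|lra|lra].
by rewrite rmorphN /=; ring.
Qed.

(** Breakpoints are removed from [s] one at a time, by cutting the interval at each of them that
    lies inside. *)
Lemma subdivision_ind (s : seq R) (T : R -> R -> Prop) :
  (forall a b, 0 <= a -> a < b -> b <= 1 ->
     (forall c, c \in s -> ~~ (a < c < b)) -> T a b) ->
  (forall a c b, 0 <= a -> a < c -> c < b -> b <= 1 ->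
     T a c -> T c b -> T a b) ->
  forall a b, 0 <= a -> a < b -> b <= 1 -> T a b.
Proof.
move=> Tfree Tcat; elim: s Tfree => [|c s IHs] Tfree.
  by move=> a b a0 ab b1; apply: Tfree.
apply: IHs => a b a0 ab b1 sab.
have [/andP[ac cb]|cab] := boolP (a < c < b); last first.
  by apply: Tfree => // d; rewrite inE => /orP[/eqP ->|/sab].
apply: (Tcat a c b) => //.
  apply: Tfree => //; first by lra.
  move=> d; rewrite inE => /orP[/eqP ->|/sab]; first by rewrite ltxx andbF.
  by apply: contra; lra.
apply: Tfree => //; first by lra.
move=> d; rewrite inE => /orP[/eqP ->|/sab]; first by rewrite ltxx.
by apply: contra; lra.
Qed.

(** [bwd f e b] is minus the slope with which [f] arrives at [b], so the sum is a difference of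
    slopes; crossing a point [c] changes the slope by [slope_sum] at [c]. The case [d = 0] says that
    the slope is constant. *)
Lemma slope_constant_mod (d : int) f e : pl_function f ->
  (forall t, 0 < t < 1 -> (d %| slope_sum f (edge_point e t))%Z) ->
  forall a b, 0 <= a -> a < b -> b <= 1 -> (d %| fwd f e a + bwd f e b)%Z.
Proof.
move=> /(_ e)[s fP] fd; apply: (@subdivision_ind s) => [a b a0 ab b1 sab|].
  have [m mP] := fP a b a0 (ltW ab) b1 sab.
  rewrite (affine_fwd mP) ?lexx // (affine_bwd mP) ?ab ?lexx //.
  by rewrite subrr dvdz0.
move=> a c b a0 ac cb b1 /= dac dcb.
have c01 : 0 < c < 1 by lra.
have := fd c c01; rewrite slope_sum_interior // => dc.
have -> : fwd f e a + bwd f e b = fwd f e a + bwd f e c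
    + (fwd f e c + bwd f e b) - (fwd f e c + bwd f e c) by ring.
by apply: rpredB; first exact: rpredD.
Qed.

Lemma slope_fwd_mod (d : int) f e t : pl_function f ->
  (forall t, 0 < t < 1 -> (d %| slope_sum f (edge_point e t))%Z) ->
  0 <= t < 1 -> (d %| fwd f e t - fwd f e 0)%Z.
Proof.
move=> fP fd /andP[t0 t1].
have -> : fwd f e t - fwd f e 0
    = fwd f e t + bwd f e 1 - (fwd f e 0 + bwd f e 1) by ring.
by rewrite rpredB // slope_constant_mod.
Qed.

Lemma affine_edge f e : pl_function f ->
  (forall t, 0 < t < 1 -> slope_sum f (edge_point e t) = 0) ->
  bwd f e 1 = - fwd f e 0 /\
  f (inl (tgt e)) - f (inl (src e)) = (fwd f e 0)%:~R.
Proof.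
move=> fP f0; have fd t : 0 < t < 1 -> (0 %| slope_sum f (edge_point e t))%Z.
  by move/f0->.
split.
  have := slope_constant_mod fP fd (lexx 0) ltr01 (lexx 1).
  by rewrite dvd0z addrC addr_eq0 => /eqP.
rewrite -edge_point1 -edge_point0.
suff T a b : 0 <= a -> a < b -> b <= 1 ->
    f (edge_point e b) - f (edge_point e a) = (fwd f e 0)%:~R * (b - a).
  by rewrite T ?ltr01 // subr0 mulr1.
move: a b; have [s fs] := fP e; apply: (@subdivision_ind s).
  move=> a b a0 ab b1 sab; have [m mP] := fs a b a0 (ltW ab) b1 sab.
  have a01 : 0 <= a < 1 by lra.
  have := slope_fwd_mod fP fd a01.
  rewrite dvd0z subr_eq0 => /eqP <-; rewrite (affine_fwd mP) ?lexx //.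
  by rewrite mP ?lexx ?ltW //; lra.
by move=> a c b _ _ _ _ /= ac cb; lra.
Qed.

(* Summation by parts: the Dirichlet energy of f is the pairing of f with its *)
(* divisor.                                                                   *)
Lemma harmonic_flat f : pl_function f -> (forall p, slope_sum f p = 0) ->
  forall e, fwd f e 0 = 0.
Proof.
move=> fP f0; have fe e := affine_edge fP (fun t (_ : 0 < t < 1) =>
  f0 (edge_point e t)).
have : \sum_(v : vertex G) f (inl v) * (slope_sum f (inl v))%:~R = 0.
  by rewrite big1 // => v _; rewrite f0 mulr0.
under eq_bigr do rewrite /= rmorphD /= !rmorph_sum /= mulrDr !mulr_sumr.
rewrite big_split /=.
rewrite (sum_fibers _ (fun v e => f (inl v) * (fwd f e 0)%:~R)).
rewrite (sum_fibers _ (fun v e => f (inl v) * (bwd f e 1)%:~R)).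
rewrite -big_split /= => energy.
(* If [s] is the slope of [f] on [e], the edge contributes [f (src e) s - f (tgt e) s], which is
   minus the square of [s]. *)
have {energy} : \sum_e ((fwd f e 0)%:~R : R) ^+ 2 = 0.
  apply/eqP; rewrite -oppr_eq0 -sumrN -[X in _ == X]energy; apply/eqP.
  apply: eq_bigr => e _; have [-> <-] := fe e.
  by rewrite rmorphN /= -(fe e).2; ring.
move=> /eqP; rewrite psumr_eq0 => [/allP energy e|e _]; last exact: sqr_ge0.
by have := energy e (mem_index_enum e); rewrite sqrf_eq0 intr_eq0 => /eqP.
Qed.

Lemma pl_divide (r : nat) f : (0 < r)%N -> pl_function f ->
  (forall e t, 0 <= t < 1 -> (r %| fwd f e t)%Z) ->
  pl_function (fun p => f p / r%:R).
Proof.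
move=> r0 fP fr e; have [s fs] := fP e; exists s => a b a0 ab b1 sab.
have [m mP] := fs a b a0 ab b1 sab.
(* On a piece reduced to a point the integer [m] is arbitrary and may fail to be divisible by
   [r]. *)
move: ab; rewrite le_eqVlt => /predU1P[ab|ab].
  exists 0 => t; rewrite -ab => tab; have -> : t = a by lra.
  by rewrite mul0r addr0.
have a01 : 0 <= a < 1 by lra.
have := fr e a a01; rewrite (affine_fwd mP) ?lexx // => /dvdzP[k km].
exists k => t /mP ->; rewrite km rmorphM /=; field.
by rewrite pnatr_eq0 -lt0n.
Qed.

End PiecewiseLinear.

(** * Torsion divisors attached to cycles modulo r *)

Section TorsionDivisor.
Variables (R : realType) (G : multigraph) (r' : nat).
Local Notation r := r'.+1.
Implicit Types (c : {ffun edge G -> 'I_r}) (e : edge G) (t : R).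

Local Notation fwd f e t := (outgoing_slope f e t false).
Local Notation bwd f e t := (outgoing_slope f e t true).

(** Reduction modulo [r], written with the additive structure alone so that [r = 1] is covered. *)
Definition residue (n : int) : 'I_r := Zp1 *~ n.

Lemma residue_ord (i : 'I_r) : residue i = i.
Proof.
rewrite /residue -pmulrn Zp_mulrn; apply: val_inj.
by rewrite /= modnMml mul1n modZp.
Qed.

Lemma residue_eq0 (n : int) : (residue n == 0) = (r %| n)%Z.
Proof.
have nat_case (k : nat) : (residue k == 0) = (r %| k)%N.
  rewrite /residue -pmulrn Zp_mulrn -val_eqE /= modnMml mul1n.
  by [].
case: n => k; first by rewrite nat_case.
by rewrite NegzE /residue mulrNz oppr_eq0 nat_case rpredN.
Qed.

Lemma boundary_residue c (s : edge G -> int) v :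
  (forall e, residue (s e) = c e) ->
  boundary c v
  = residue (\sum_(e | src e == v) s e - \sum_(e | tgt e == v) s e).
Proof.
move=> sc; rewrite ffunE /residue mulrzBr !mulrz_sumr.
by congr (_ - _); apply: eq_bigr => e _; rewrite -sc.
Qed.

(** The parameter at which the lines of slopes [c e] and [c e - r], vanishing at 0 and at 1, meet.
    It equals 1, and so is not interior, exactly when [c e = 0]. *)
Definition kink c e : R := (r%:R - (c e)%:R) / r%:R.

(* Each edge carries the tent function of slopes c e and c e - r that         *)
(* vanishes at both ends; its slopes are congruent to c e modulo r.           *)
Definition tent c (p : Defs.point R G) : R :=
  match p with
  | inl _ => 0
  | inr x => let: (e, t) := val x in
             Num.min ((c e)%:R * t) ((r%:R - (c e)%:R) * (1 - t))
  end.

Lemma kink_mul c e : r%:R * kink c e = r%:R - (c e)%:R.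
Proof. by rewrite mulrC /kink divfK // pnatr_eq0. Qed.

Lemma natr_gt0 : (0 : R) < r%:R. Proof. by rewrite ltr0n. Qed.

Lemma kink_gt0 c e : 0 < kink c e.
Proof. by rewrite divr_gt0 ?natr_gt0 // subr_gt0 ltr_nat. Qed.

Lemma kink_le1 c e : kink c e <= 1.
Proof. by rewrite ler_pdivrMr ?natr_gt0 // mul1r gerBl ler0n. Qed.

Lemma kink_lt1 c e : (kink c e < 1) = (c e != 0).
Proof. by rewrite ltr_pdivrMr ?natr_gt0 // mul1r gtrBl ltr0n lt0n. Qed.

Lemma tent_edge_point c e t : 0 <= t <= 1 ->
  tent c (edge_point e t)
  = Num.min ((c e)%:R * t) ((r%:R - (c e)%:R) * (1 - t)).
Proof.
have cr : ((c e)%:R : R) <= r%:R by rewrite ler_nat ltnW.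
have c0 : (0 : R) <= (c e)%:R by rewrite ler0n.
move=> /andP[]; rewrite le_eqVlt => /predU1P[<- _|t0].
  by rewrite edge_point0 /= mulr0 subr0 mulr1 min_l // subr_ge0.
rewrite le_eqVlt => /predU1P[->|t1].
  by rewrite edge_point1 /= subrr mulr1 mulr0 min_r.
have t01 : 0 < t < 1 by rewrite t0.
by have [x -> xE] := edge_pointI e t01; rewrite /tent xE.
Qed.

Lemma tent_left c e t : 0 <= t <= kink c e ->
  tent c (edge_point e t) = (c e)%:R * t.
Proof.
have := kink_le1 c e => k1 /andP[t0 tk].
rewrite tent_edge_point ?t0 ?(le_trans tk) // min_l //.
have : r%:R * t <= r%:R * kink c e by rewrite ler_pM2l ?natr_gt0.
by rewrite kink_mul; lra.
Qed.

Lemma tent_right c e t : kink c e <= t <= 1 ->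
  tent c (edge_point e t) = (r%:R - (c e)%:R) * (1 - t).
Proof.
have := kink_gt0 c e => k0 /andP[kt t1].
rewrite tent_edge_point ?t1 ?(le_trans (ltW k0)) // min_r //.
have : r%:R * kink c e <= r%:R * t by rewrite ler_pM2l ?natr_gt0.
by rewrite kink_mul; lra.
Qed.

Lemma tent_affine_left c e a t : 0 <= a -> a <= t <= kink c e ->
  tent c (edge_point e t)
  = tent c (edge_point e a) + ((c e)%:Z)%:~R * (t - a).
Proof. by move=> a0 /andP[at_ tk]; rewrite !tent_left //; [ring|lra|lra]. Qed.

Lemma tent_affine_right c e a t : kink c e <= a -> a <= t <= 1 ->
  tent c (edge_point e t)
  = tent c (edge_point e a) + ((c e)%:Z - r%:Z)%:~R * (t - a).
Proof.
move=> ka /andP[at_ t1]; rewrite !tent_right; [|lra|lra].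
by rewrite rmorphB /=; ring.
Qed.

Lemma pl_tent c : pl_function (tent c).
Proof.
move=> e; exists [:: kink c e] => a b a0 ab b1 /(_ _ (mem_head _ _)) nk.
have [bk|kb] := leP b (kink c e).
  exists (c e)%:Z => t tab; apply: tent_affine_left => //; lra.
exists ((c e)%:Z - r%:Z) => t tab.
have ka : kink c e <= a.
  by rewrite leNgt; apply: contra nk => ->.
by apply: tent_affine_right => //; lra.
Qed.

Lemma tent_fwd_left c e t : 0 <= t < kink c e -> fwd (tent c) e t = c e.
Proof. exact: affine_fwd (@tent_affine_left c e 0 ^~ (lexx 0)) t. Qed.

Lemma tent_fwd_right c e t : kink c e <= t < 1 ->
  fwd (tent c) e t = (c e)%:Z - r%:Z.
Proof. exact: affine_fwd (@tent_affine_right c e _ ^~ (lexx _)) t. Qed.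

Lemma tent_bwd_left c e t : 0 < t <= kink c e -> bwd (tent c) e t = - (c e)%:Z.
Proof. exact: affine_bwd (@tent_affine_left c e 0 ^~ (lexx 0)) t. Qed.

Lemma tent_bwd_right c e t : kink c e < t <= 1 ->
  bwd (tent c) e t = r%:Z - (c e)%:Z.
Proof.
move=> kt; rewrite (affine_bwd (@tent_affine_right c e _ ^~ (lexx _)) kt).
by rewrite opprB.
Qed.

Lemma tent_fwd0 c e : fwd (tent c) e 0 = c e.
Proof. by rewrite tent_fwd_left // lexx kink_gt0. Qed.

Lemma tent_fwd_mod c e t : 0 <= t < 1 ->
  (r %| fwd (tent c) e t - (c e)%:Z)%Z.
Proof.
move=> /andP[t0 t1]; have [kt|tk] := leP (kink c e) t.
  by rewrite tent_fwd_right ?kt // addrAC subrr add0r rpredN dvdzz.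
by rewrite tent_fwd_left ?t0 // subrr dvdz0.
Qed.

Lemma tent_bwd1 c e : bwd (tent c) e 1 = (r * (c e != 0%R))%N%:Z - (c e)%:Z.
Proof.
have [k1|] := ltP (kink c e) 1.
  by rewrite tent_bwd_right ?k1 ?lexx // -kink_lt1 k1 muln1.
move=> k1; rewrite tent_bwd_left ?ltr01 //.
by rewrite -kink_lt1 ltNge k1 muln0 sub0r.
Qed.

Lemma slope_sum_tent_vertex c v :
  slope_sum (tent c) (inl v)
  = \sum_(e | src e == v) (c e)%:Z - \sum_(e | tgt e == v) (c e)%:Z
    + r%:Z * \sum_(e | tgt e == v) (c e != 0%R)%:Z.
Proof.
rewrite /slope_sum; under eq_bigr do rewrite tent_fwd0.
under [X in _ + X]eq_bigr do rewrite tent_bwd1 PoszM.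
by rewrite sumrB -mulr_sumr; ring.
Qed.

Lemma slope_sum_tent_edge c e t : 0 < t < 1 ->
  slope_sum (tent c) (edge_point e t) = - (r * (t == kink c e))%N%:Z.
Proof.
move=> /andP[t0 t1]; rewrite slope_sum_interior ?t0 //.
have [tk|kt|tk] := ltgtP t (kink c e).
- by rewrite tent_fwd_left ?tk ?ltW // tent_bwd_left ?t0 ?ltW // muln0; lia.
- by rewrite tent_fwd_right ?t1 ?ltW // tent_bwd_right ?kt ?ltW // muln0; lia.
rewrite tent_fwd_right -?tk ?lexx // tent_bwd_left -?tk ?t0 ?lexx // muln1.
lia.
Qed.

Definition vertex_coeff c v : int := (slope_sum (tent c) (inl v) %/ r)%Z.

(** The divisor of [tent c] divided by [r]: the slope drops by [r] at each interior kink, whence the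
    coefficient -1. At the vertices the division is exact when [c] is a cycle. *)
Definition torsion_divisor c : divisor R G :=
  \sum_v << vertex_coeff c v *g inl v >>
  - \sum_(e | c e != 0%R) << edge_point e (kink c e) >>.

Lemma coeff_torsion_divisor_vertex c v :
  coeff (inl v) (torsion_divisor c) = vertex_coeff c v.
Proof.
rewrite coeffB !(raddf_sum (coeff (inl v))) (bigD1 v) //=.
rewrite coeffU eqxx mulr1.
rewrite big1 ?addr0 => [|w /negPf wv]; last first.
  by rewrite coeffU -[inl w == inl v]/(w == v) wv mulr0.
rewrite big1 ?subr0 // => e ce.
have k01 : 0 < kink c e < 1 by rewrite kink_gt0 kink_lt1.
by have [x -> _] := edge_pointI e k01; rewrite coeffU mulr0.
Qed.

Lemma coeff_torsion_divisor_edge c e t : 0 < t < 1 ->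
  coeff (edge_point e t) (torsion_divisor c) = - (t == kink c e)%:Z.
Proof.
move=> t01; have [x xE valx] := edge_pointI e t01.
rewrite xE coeffB !(raddf_sum (coeff (inr x : Defs.point R G))) /=.
rewrite big1 ?sub0r => [|v _]; last first.
  by rewrite coeffU mulr0.
congr (- _); have [tk|tk] := eqVneq t (kink c e).
  have ce : c e != 0 by rewrite -(@kink_lt1 c e) -tk; case/andP: t01.
  rewrite (bigD1 e) //= -tk xE coeffU eqxx mulr1.
  rewrite big1 ?addr0 // => e' /andP[ce' e'e].
  have k01 : 0 < kink c e' < 1 by rewrite kink_gt0 kink_lt1.
  have [y -> valy] := edge_pointI e' k01.
  rewrite coeffU; case: eqP => [[yx]|]; last by rewrite mulr0.
  by move: e'e; rewrite -[e']/((e', kink c e').1) -valy yx valx eqxx.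
apply: big1 => e' ce'.
have k01 : 0 < kink c e' < 1 by rewrite kink_gt0 kink_lt1.
have [y -> valy] := edge_pointI e' k01.
rewrite coeffU; case: eqP => [[yx]|]; last by rewrite mulr0.
by move: valy tk; rewrite yx valx => -[-> ->]; rewrite eqxx.
Qed.

Lemma point_cases (p : Defs.point R G) :
  (exists v, p = inl v) \/
  (exists e, exists2 t, 0 < t < 1 & p = edge_point e t).
Proof.
case: p => [v|x]; [by left; exists v|right].
by exists (val x).1, (val x).2; [exact: (valP x)|rewrite edge_point_interior].
Qed.

Lemma torsion_divisor_Vreg c : {subset dom (torsion_divisor c) <= Vreg r}.
Proof.
move=> p; rewrite mem_dom; case: (point_cases p) => [[v ->]//|[e [t t01 ->]]].
rewrite coeff_torsion_divisor_edge //.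
have [tk|] := eqVneq t (kink c e); last by rewrite oppr0 eqxx.
move=> _; have [x -> valx] := edge_pointI e t01.
have ce : c e != 0 by rewrite -(@kink_lt1 c e) -tk; case/andP: t01.
(* The kink is the division point of index [r - c e]. *)
have cr : (r - c e < r)%N by rewrite ltn_subrL lt0n ce.
apply/existsP; exists (Ordinal cr).
by rewrite valx /= natrB ?tk // ltnW.
Qed.

Lemma cycleP c : reflect
  (forall v, r %| \sum_(e | src e == v) (c e)%:Z
                  - \sum_(e | tgt e == v) (c e)%:Z)%Z
  (boundary c == 0).
Proof.
have cb v := boundary_residue v (fun e => residue_ord (c e)).
apply: (iffP eqP) => [c0 v|c0].
  by rewrite -residue_eq0 -cb c0 ffunE.
by apply/ffunP => v; apply/eqP; rewrite cb ffunE residue_eq0 c0.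
Qed.

Lemma torsion_divisor_mul c p : boundary c == 0 ->
  coeff p (torsion_divisor c *+ r) = slope_sum (tent c) p.
Proof.
move=> /cycleP c0; rewrite coeffMn.
case: (point_cases p) => [[v ->]|[e [t t01 ->]]].
  rewrite coeff_torsion_divisor_vertex /vertex_coeff -mulr_natr natz divzK //.
  by rewrite slope_sum_tent_vertex rpredD // dvdz_mulr.
rewrite coeff_torsion_divisor_edge // slope_sum_tent_edge //.
by rewrite PoszM -mulr_natr natz mulNr mulrC.
Qed.

Lemma deg_torsion_divisor c : boundary c == 0 -> deg (torsion_divisor c) = 0.
Proof.
move=> c0; have degE : deg (torsion_divisor c)
    = \sum_v vertex_coeff c v - \sum_e (c e != 0%R)%:Z.
  rewrite degB !(raddf_sum (@deg _)) /=; congr (_ - _).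
    by apply: eq_bigr => v _; rewrite degU.
  by rewrite big_mkcond; apply: eq_bigr => e _; case: eqP; rewrite ?degU.
(* After multiplication by [r] the vertex coefficients become slope sums of [tent c]. Summed over
   vertices, the terms [c e] cancel, and each edge with [c e] nonzero leaves an [r] at its target
   that offsets its kink. *)
apply: (@mulIf _ r%:Z) => //; rewrite mul0r degE mulrBl mulr_suml.
under eq_bigr => v _ do
  rewrite -coeff_torsion_divisor_vertex -natz mulr_natr -coeffMn
    torsion_divisor_mul // slope_sum_tent_vertex.
rewrite big_split sumrB -mulr_sumr /=.
rewrite !(sum_fibers _ (fun _ e => (c e)%:Z)) subrr add0r.
by rewrite (sum_fibers _ (fun _ e => (c e != 0%R)%:Z)) mulrC subrr.
Qed.

Lemma torsion_divisor_inj c c' : boundary c == 0 -> boundary c' == 0 ->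
  lin_equiv (torsion_divisor c) (torsion_divisor c') -> c = c'.
Proof.
move=> c0 c'0 /asboolP[h hP hD].
have fP := pl_sub (pl_tent c) (pl_tent c').
(* The function [tent c - tent c' - r h] has zero divisor, so its initial slopes vanish and
   [c e - c' e] is [r] times a slope of [h]. *)
have rhP := pl_scale r hP.
have flat := harmonic_flat (pl_sub fP rhP).
apply/ffunP => e; rewrite -[c e]residue_ord -[c' e]residue_ord.
apply/eqP; rewrite -subr_eq0 /residue -mulrzBr -/(residue _).
rewrite residue_eq0 -!tent_fwd0.
have r01 : 0 <= (0 : R) < 1 by rewrite lexx ltr01.
rewrite -outgoing_fwdB //; [|exact: pl_tent|exact: pl_tent].
have := flat _ e; rewrite outgoing_fwdB // outgoing_fwdZ // => fe.
rewrite (subr0_eq (fe _)) ?dvdz_mulr // => p.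
rewrite slope_sumB // slope_sumZ // slope_sumB //; try exact: pl_tent.
rewrite -hD -!torsion_divisor_mul // -coeffB -mulrnBl coeffMn.
by rewrite -mulr_natl natz subrr.
Qed.

Lemma torsion_divisor_surj (D : divisor R G) : D *+ r \in @principal R G ->
  exists2 c, boundary c == 0 & lin_equiv (torsion_divisor c) D.
Proof.
move=> /asboolP[f fP fD].
have fr p : (r %| slope_sum f p)%Z.
  by rewrite -fD coeffMn -mulr_natr natz dvdz_mull.
pose c : {ffun edge G -> 'I_r} := [ffun e => residue (fwd f e 0)].
have ce e : residue (fwd f e 0) = c e by rewrite ffunE.
have c0 : boundary c == 0.
  apply/eqP/ffunP => v; apply/eqP.
  rewrite (boundary_residue v ce) ffunE residue_eq0.
  (* Up to multiples of [r], the slope leaving the target of [e] is minus the initial slope, so the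
     boundary at [v] is the slope sum of [f] there. *)
  have -> : \sum_(e | src e == v) fwd f e 0 - \sum_(e | tgt e == v) fwd f e 0
      = slope_sum f (inl v)
        - \sum_(e | tgt e == v) (fwd f e 0 + bwd f e 1).
    by rewrite /slope_sum big_split /=; ring.
  rewrite rpredB // rpred_sum // => e _.
  by apply: (slope_constant_mod fP) => // t _.
exists c => //; apply/asboolP.
have gP := pl_sub (pl_tent c) fP.
have qP : pl_function (fun p => (tent c p - f p) / r%:R).
  apply: pl_divide gP _ => // e t t01.
  rewrite outgoing_fwdB //; last exact: pl_tent.
  have ft := slope_fwd_mod fP
    (fun t (_ : 0 < t < 1) => fr (edge_point e t)) t01.
  have fc : (r %| (c e)%:Z - fwd f e 0)%Z.
    rewrite -residue_eq0 /residue mulrzBr -!/(residue _).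
    by rewrite residue_ord ce subrr.
  have -> : fwd (tent c) e t - fwd f e t = fwd (tent c) e t - (c e)%:Z
     + ((c e)%:Z - fwd f e 0) - (fwd f e t - fwd f e 0) by ring.
  by rewrite rpredB // rpredD // tent_fwd_mod.
exists (fun p => (tent c p - f p) / r%:R) => // p.
apply: (@mulIf _ r%:Z) => //; rewrite [RHS]mulrC -slope_sumZ //.
rewrite -natz mulr_natr -coeffMn mulrnBl coeffB fD torsion_divisor_mul //.
rewrite -slope_sumB //; last exact: pl_tent.
congr (slope_sum _ p); apply/funext => q.
by rewrite mulrC natz divfK // pnatr_eq0.
Qed.

End TorsionDivisor.

(** * Linear equivalence as equality of classes, and the conclusion *)

Section Pic.
Variables (R : realType) (G : multigraph).
Implicit Types D : divisor R G.

Lemma divisor_class_eq D D' :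
  divisor_class D = divisor_class D' <-> lin_equiv D D'.
Proof.
rewrite /lin_equiv Quotient.idealrBE.
by split => [/eqP|/eqP].
Qed.

Lemma divisor_classMn D n : divisor_class (D *+ n) = divisor_class D *+ n.
Proof. by rewrite /divisor_class raddfMn. Qed.

Lemma divisor_class0 : @divisor_class R G 0 = 0.
Proof. by rewrite /divisor_class raddf0. Qed.

End Pic.

Theorem proposition7p10 (R : realType) (r : nat) (r_gt0 : (0 < r)%N)
    (G : multigraph) (G_connected : connected_graph G) :
  exists D : 'I_(r ^ genus G) -> divisor R G,
    (forall i, {subset dom (D i) <= Vreg r})
    /\ (forall i j, i != j -> ~ lin_equiv (D i) (D j))
    /\ [set divisor_class (D i) | i in [set: 'I_(r ^ genus G)]]%classic
       = @Pic0_torsion R G r.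
Proof.
case: r r_gt0 => // r' _.
have Ncycles : #|cycles G 'I_r'.+1| = (r'.+1 ^ genus G)%N.
  by rewrite card_cycles // card_ord.
pose c i := enum_val (cast_ord (esym Ncycles) i).
have c0 i : boundary (c i) == 0.
  by have := enum_valP (cast_ord (esym Ncycles) i); rewrite inE.
have rclass D : divisor_class D *+ r'.+1 = 0 <-> D *+ r'.+1 \in @principal R G.
  rewrite -divisor_classMn -[D *+ _ in X in _ <-> X]subr0 -divisor_class0.
  exact: divisor_class_eq.
exists (fun i => torsion_divisor R (c i)); split; last split.
- by move=> i; exact: torsion_divisor_Vreg.
- move=> i j ij /(torsion_divisor_inj (c0 i) (c0 j)).
  move=> /enum_val_inj /cast_ord_inj cij.
  by rewrite cij eqxx in ij.
apply/seteqP; split => [_ [i _ <-]|_ [[D D0 <-]]].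
  split.
    exists (torsion_divisor R (c i)) => //; exact: deg_torsion_divisor.
  apply/rclass/asboolP; exists (tent (c i)); first exact: pl_tent.
  by move=> p; rewrite torsion_divisor_mul.
move=> /rclass /torsion_divisor_surj[c' c'0 c'D].
have c'cycle : c' \in cycles G 'I_r'.+1 by rewrite inE.
exists (cast_ord Ncycles (enum_rank_in c'cycle c')) => //.
rewrite /c cast_ordK enum_rankK_in //.
exact/divisor_class_eq.
Qed.
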